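(* For every positive integer $k$ and every integer $n \ge 3$, we have $\chi'_{st}(C_{3k} \,\square\, P_n) = 6$.
   Context: A star edge-coloring of a graph $G$ is a proper edge-coloring of $G$ in which there is no bichromatic path and no bichromatic cycle of length four (i.e., with four edges). The star chromatic index $\chi'_{st}(G)$ is the minimum number of colors in a star edge-coloring of $G$. $C_m$ denotes the cycle on $m$ vertices and $P_n$ the path on $n$ vertices. $G \,\square\, H$ denotes the Cartesian product: vertex set $V(G)\times V(H)$, with $(u,v)(u',v')$ an edge iff either $uu'\in E(G)$ and $v=v'$, or $u=u'$ and $vv'\in E(H)$. *)

(* Defs.v *)
From mathcomp Require Import all_boot.

Set Implicit Arguments.
Unset Strict Implicit.
Unset Printing Implicit Defensive.

Record sgraph := SGraph {
  vertex :> finType;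
  adj : rel vertex;
  adj_sym : symmetric adj;
  adj_irrefl : irreflexive adj
}.

Section StarEdgeColoring.
Variable G : sgraph.

Definition edges : {set {set G}} :=
  [set [set xy.1; xy.2] | xy : G * G & adj xy.1 xy.2].

Definition edge := {e : {set G} | e \in edges}.

Definition path_edges (s : seq G) : seq {set G} :=
  [seq [set xy.1; xy.2] | xy <- zip s (behead s)].

Definition cycle_edges (s : seq G) : seq {set G} :=
  [seq [set xy.1; xy.2] | xy <- zip s (rot 1 s)].

Section Coloring.
Variables (C : finType) (c : {ffun edge -> C}).

Definition proper_edge_coloring : bool :=
  [forall e : edge, forall f : edge,
     (e != f) && ~~ [disjoint val e & val f] ==> (c e != c f)].

Definition bichromatic (es : seq {set G}) : bool :=
  #|[set c e | e : edge & val e \in es]| == 2.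

(* Paths and cycles are lists of pairwise distinct vertices, so a path with
   four edges is a 5-tuple and a cycle with four edges is a 4-tuple. *)
Definition star_edge_coloring : bool :=
  [&& proper_edge_coloring,
      [forall t : 5.-tuple G,
         uniq t && sorted (@adj G) t ==> ~~ bichromatic (path_edges t)]
    & [forall t : 4.-tuple G,
         uniq t && cycle (@adj G) t ==> ~~ bichromatic (cycle_edges t)]].

End Coloring.

Definition star_edge_colorable (k : nat) : bool :=
  [exists c : {ffun edge -> 'I_k}, star_edge_coloring c].

Lemma edge_of (x y : G) : adj x y -> exists e : edge, val e = [set x; y].
Proof.
move=> xy; have h : [set x; y] \in edges.
  by apply/imsetP; exists (x, y) => //; rewrite inE.
by exists (Sub [set x; y] h).
Qed.

Lemma inj_not_bichromatic (C : finType) (c : {ffun edge -> C}) es (x y z w : G) :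
  injective c -> uniq [:: x; y; z; w] -> adj x y -> adj y z -> adj z w ->
  {subset [:: [set x; y]; [set y; z]; [set z; w]] <= es} ->
  ~~ bichromatic c es.
Proof.
move=> cI; rewrite /= !inE !negb_or -!andbA => /and5P[xy xz xw yz /and3P[yw zw _]].
move=> /edge_of[e he] /edge_of[f hf] /edge_of[g hg] sub.
rewrite /bichromatic card_imset // neq_ltn; apply/orP; right.
have ef : e != f.
  apply/eqP => ef; have := set21 x y; rewrite -he ef hf !inE.
  by rewrite (negPf xy) (negPf xz).
have eg : e != g.
  apply/eqP => eg; have := set21 x y; rewrite -he eg hg !inE.
  by rewrite (negPf xz) (negPf xw).
have fg : f != g.
  apply/eqP => fg; have := set21 y z; rewrite -hf fg hg !inE.
  by rewrite (negPf yz) (negPf yw).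
have u : uniq [:: e; f; g] by rewrite /= !inE negb_or ef eg fg.
rewrite -[3]/(size [:: e; f; g]) -(card_uniqP u).
apply/subset_leq_card/subsetP => a; rewrite !inE => /or3P[] /eqP->;
  by apply: sub; rewrite ?he ?hf ?hg !inE eqxx ?orbT.
Qed.

Lemma star_edge_colorable_exists : exists k, star_edge_colorable k.
Proof.
exists #|{: edge}|; apply/existsP; exists [ffun e => enum_rank e].
have cI : injective [ffun e : edge => enum_rank e].
  by move=> e f; rewrite !ffunE; apply: enum_rank_inj.
apply/and3P; split.
- apply/forallP => e; apply/forallP => f; apply/implyP => /andP[ef _].
  by rewrite (inj_eq cI).
- apply/forallP => -[[|x [|y [|z [|w [|v [|? ?]]]]]] //= ?].
  apply/implyP => /andP[u /and5P[xy yz zw _ _]].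
  apply: (inj_not_bichromatic cI (x := x) (y := y) (z := z) (w := w)) => //.
    exact: (take_uniq 4 (u : uniq [:: x; y; z; w; v])).
  by move=> a; rewrite !inE => /or3P[] ->; rewrite ?orbT.
- apply/forallP => -[[|x [|y [|z [|w [|? ?]]]]] //= ?].
  apply/implyP => /andP[u /and5P[xy yz zw _ _]].
  apply: (inj_not_bichromatic cI (x := x) (y := y) (z := z) (w := w)) => //.
  by move=> a; rewrite !inE => /or3P[] ->; rewrite ?orbT.
Qed.

Definition star_chromatic_index : nat := ex_minn star_edge_colorable_exists.

End StarEdgeColoring.

Section CycleGraph.
Variable m : nat.

(* For m >= 3 this is the cycle on m vertices; the test i != j only excludes
   the loop that would arise for m = 1. *)
Definition cycle_adj : rel 'I_m :=
  [rel i j | (i != j) && ((j == ordS i) || (i == ordS j))].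

Lemma cycle_adj_sym : symmetric cycle_adj.
Proof. by move=> i j; rewrite /cycle_adj /= eq_sym orbC. Qed.

Lemma cycle_adj_irrefl : irreflexive cycle_adj.
Proof. by move=> i; rewrite /cycle_adj /= eqxx. Qed.

Definition cycle_graph := SGraph cycle_adj_sym cycle_adj_irrefl.
End CycleGraph.

Section PathGraph.
Variable n : nat.

Definition path_adj : rel 'I_n :=
  [rel i j : 'I_n | (j == i.+1 :> nat) || (i == j.+1 :> nat)].

Lemma path_adj_sym : symmetric path_adj.
Proof. by move=> i j; rewrite /path_adj /= orbC. Qed.

Lemma path_adj_irrefl : irreflexive path_adj.
Proof. by move=> i; rewrite /path_adj /= orbb ltn_eqF. Qed.

Definition path_graph := SGraph path_adj_sym path_adj_irrefl.
End PathGraph.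

Section CartesianProduct.
Variables G H : sgraph.

Definition cartesian_adj : rel (G * H) :=
  [rel x y | adj x.1 y.1 && (x.2 == y.2) || (x.1 == y.1) && adj x.2 y.2].

Lemma cartesian_adj_sym : symmetric cartesian_adj.
Proof.
by move=> x y; rewrite /cartesian_adj /= (adj_sym x.1) (adj_sym x.2) (eq_sym x.1) (eq_sym x.2).
Qed.

Lemma cartesian_adj_irrefl : irreflexive cartesian_adj.
Proof. by move=> x; rewrite /cartesian_adj /= !adj_irrefl andbF. Qed.

Definition cartesian_product := SGraph cartesian_adj_sym cartesian_adj_irrefl.
End CartesianProduct.

(* Main.v *)
(** Call a walk [x0 x1 x2 x3 x4] non-backtracking if [x0 != x2], [x1 != x3] and
    [x2 != x4].  A proper edge-coloring is a star edge-coloring iff no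
    non-backtracking walk has colors [a b a b]: such a walk is a path, a
    4-cycle, or contains a triangle, whose edges have three distinct colors.
    This condition pulls back along homomorphisms that are injective on
    neighborhoods.  For the upper bound, reduction modulo 3 in both coordinates
    maps [C_3k x P_n] to [K_3 x K_3], which has an explicit star 6-coloring that
    is linear over Z/3.  For the lower bound, the strip of width 3 over the
    natural numbers maps to [C_3k x P_n], and an exhaustive search shows that
    already its first five columns have no star 5-coloring. *)

Require Import Defs.
From mathcomp Require Import all_boot.
From mathcomp Require Import zify.

Set Implicit Arguments.
Unset Strict Implicit.
Unset Printing Implicit Defensive.

(** * Star colorings of non-backtracking walks *)

(** Colors sit on ordered pairs of vertices, so that pulling back is mere composition. As [x0 = x4]
    is allowed, the last clause covers 4-cycles as well as paths. *)
Definition star_walk_coloring (V : eqType) (r : rel V) (k : nat)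
    (col : V -> V -> nat) : Prop :=
  [/\ forall x y, r x y -> col x y < k,
      forall x y, r x y -> col x y = col y x,
      forall x y z, r x y -> r y z -> x != z -> col x y != col y z
    & forall x0 x1 x2 x3 x4, r x0 x1 -> r x1 x2 -> r x2 x3 -> r x3 x4 ->
        x0 != x2 -> x1 != x3 -> x2 != x4 ->
        ~~ ((col x0 x1 == col x2 x3) && (col x1 x2 == col x3 x4))].

Lemma star_walk_coloring_pullback (U V : eqType) (s : rel U) (r : rel V) k col
    (f : U -> V) :
  (forall x y, s x y -> r (f x) (f y)) ->
  (forall x y z, s x y -> s y z -> f x = f z -> x = z) ->
  star_walk_coloring r k col ->
  star_walk_coloring s k (fun x y => col (f x) (f y)).
Proof.
move=> fH fI [bnd csym prop star].
have nb x y z : s x y -> s y z -> x != z -> f x != f z.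
  by move=> xy yz; apply: contra_neq; apply: fI xy yz.
split=> [x y /fH|x y /fH|x y z xy yz xz|x0 x1 x2 x3 x4 e1 e2 e3 e4 n1 n2 n3].
- exact: bnd.
- exact: csym.
- exact: prop (fH _ _ xy) (fH _ _ yz) (nb _ _ _ xy yz xz).
- by apply: star; rewrite ?fH //;
    [apply: nb e1 e2 n1|apply: nb e2 e3 n2|apply: nb e3 e4 n3].
Qed.

(** * Star edge-colorings versus walk colorings *)

Section WalkCharacterization.
Variable G : sgraph.

(** When consecutive colors differ, two colors in all can only alternate. *)
Lemma bichromatic4E (C : finType) (c : {ffun edge G -> C}) (e1 e2 e3 e4 : edge G) :
  c e1 != c e2 -> c e2 != c e3 -> c e3 != c e4 ->
  bichromatic c [:: val e1; val e2; val e3; val e4] =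
    (c e1 == c e3) && (c e2 == c e4).
Proof.
move=> n12 n23 n34; rewrite /bichromatic.
have -> : [set c e | e : edge G & val e \in [:: val e1; val e2; val e3; val e4]]
        = [set c e1; c e2; c e3; c e4].
  apply/setP => a; apply/imsetP/idP => [[e]|].
    by rewrite !inE !val_eqE => /or4P[]/eqP-> ->; rewrite eqxx ?orbT.
  by rewrite !inE -!orbA => /or4P[]/eqP->;
    [exists e1|exists e2|exists e3|exists e4]; rewrite // !inE eqxx ?orbT.
apply/idP/andP => [/cards2P[a [b [ab eqS]]]|[/eqP<- /eqP<-]]; last first.
  have -> : [set c e1; c e2; c e1; c e2] = [set c e1; c e2].
    by apply/setP=> a; rewrite !inE; case: (a == c e1); case: (a == c e2).
  by rewrite cards2 n12.
have inS i : i \in [set c e1; c e2; c e3; c e4] -> (i == a) || (i == b).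
  by rewrite eqS !inE.
have h1 : c e1 \in [set c e1; c e2; c e3; c e4] by rewrite !inE eqxx.
have h2 : c e2 \in [set c e1; c e2; c e3; c e4] by rewrite !inE eqxx ?orbT.
have h3 : c e3 \in [set c e1; c e2; c e3; c e4] by rewrite !inE eqxx ?orbT.
have h4 : c e4 \in [set c e1; c e2; c e3; c e4] by rewrite !inE eqxx ?orbT.
move: (inS _ h1) (inS _ h2) (inS _ h3) (inS _ h4) n12 n23 n34.
by case/orP=> /eqP->; case/orP=> /eqP->; case/orP=> /eqP->; case/orP=> /eqP->;
  rewrite ?eqxx.
Qed.

Lemma edge_set_neq (x y z : G) : x != z -> x != y -> [set x; y] != [set y; z].
Proof.
move=> xz xy; apply/eqP => E; have := set21 x y.
by rewrite E !inE (negPf xy) (negPf xz).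
Qed.

Lemma adj_neq (x y : G) : adj x y -> x != y.
Proof. by apply: contraTneq => ->; rewrite adj_irrefl. Qed.

Definition walk_color k (c : {ffun edge G -> 'I_k}) (x y : G) : nat :=
  if insub [set x; y] is Some e then c e else 0.

Lemma walk_colorE k (c : {ffun edge G -> 'I_k}) (e : edge G) x y :
  val e = [set x; y] -> walk_color c x y = c e.
Proof. by move=> he; rewrite /walk_color -he valK. Qed.

Lemma star_edge_coloring_walk k (c : {ffun edge G -> 'I_k}) :
  star_edge_coloring c -> star_walk_coloring (@adj G) k (walk_color c).
Proof.
case/and3P=> /forallP prop /forallP pth /forallP cyc.
have csym x y : walk_color c x y = walk_color c y x.
  by rewrite /walk_color setUC.
have proper x y z : adj x y -> adj y z -> x != z ->
    walk_color c x y != walk_color c y z.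
  move=> xy yz xz; have [e he] := edge_of xy; have [f hf] := edge_of yz.
  rewrite (walk_colorE c he) (walk_colorE c hf) val_eqE.
  have /forallP/(_ f)/implyP -> // := prop e.
  rewrite -val_eqE he hf (edge_set_neq xz (adj_neq xy)) /=.
  by apply/pred0Pn; exists y; rewrite /= !inE eqxx ?orbT.
split=> //.
  by move=> x y /edge_of[e he]; rewrite (walk_colorE c he) ltn_ord.
move=> x0 x1 x2 x3 x4 a01 a12 a23 a34 n02 n13 n24; apply/negP => /andP[/eqP E1 /eqP E2].
(* If [x0 = x3], the edges [x0 x1] and [x2 x3] meet at [x0], and properness contradicts [E1]; [n14]
   is similar. *)
have n03 : x0 != x3.
  apply: contra_eq_neq E1 => E; rewrite -E in a23 *.
  rewrite [walk_color c x0 x1]csym [walk_color c x2 x0]csym.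
  by apply: proper (adj_neq a12); rewrite adj_sym.
have n14 : x1 != x4.
  apply: contra_eq_neq E2 => E; rewrite -E in a34 *.
  rewrite [walk_color c x1 x2]csym [walk_color c x3 x1]csym.
  by apply: proper (adj_neq a23); rewrite adj_sym.
have [e1 h1] := edge_of a01; have [e2 h2] := edge_of a12.
have [e3 h3] := edge_of a23; have [e4 h4] := edge_of a34.
have m1 := proper _ _ _ a01 a12 n02; have m2 := proper _ _ _ a12 a23 n13.
have m3 := proper _ _ _ a23 a34 n24.
move: m1 m2 m3 E1 E2; rewrite (walk_colorE c h1) (walk_colorE c h2).
rewrite (walk_colorE c h3) (walk_colorE c h4) !val_eqE.
move=> m1 m2 m3 /val_inj E1 /val_inj E2.
have bi : bichromatic c [:: [set x0; x1]; [set x1; x2]; [set x2; x3]; [set x3; x4]].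
  by rewrite -h1 -h2 -h3 -h4 bichromatic4E // E1 E2 !eqxx.
have [[[n01 n12] n23] n34] := (adj_neq a01, adj_neq a12, adj_neq a23, adj_neq a34).
have [E04|n04] := eqVneq x0 x4.
  have := cyc [tuple x0; x1; x2; x3]; rewrite /= !inE !negb_or.
  rewrite n01 n02 n03 n12 n13 n23 a01 a12 a23 E04 a34 /=.
  by rewrite /cycle_edges /= -{1}E04 bi.
have := pth [tuple x0; x1; x2; x3; x4]; rewrite /= !inE !negb_or.
rewrite n01 n02 n03 n04 n12 n13 n14 n23 n24 n34 a01 a12 a23 a34 /=.
by rewrite /path_edges /= bi.
Qed.

Lemma edge_at (e : edge G) z :
  z \in val e -> exists2 x, adj x z & val e = [set x; z].
Proof.
case: e => s /= /imsetP[[x y]]; rewrite inE /= => xy ->; rewrite !inE.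
case/orP=> /eqP->; last by exists x.
by exists y; rewrite 1?adj_sym // setUC.
Qed.

Lemma set2_inj (x y a b : G) :
  x != y -> [set x; y] = [set a; b] -> x = a /\ y = b \/ x = b /\ y = a.
Proof.
move=> xy E; have := set21 x y; have := set22 x y; rewrite E !inE.
by case/orP=> /eqP Ey; case/orP=> /eqP Ex; subst; rewrite ?eqxx in xy *; auto.
Qed.

Lemma star_walk_coloring_edge k col :
  star_walk_coloring (@adj G) k.+1 col -> star_edge_colorable G k.+1.
Proof.
case=> bnd csym prop star.
(* [ends] picks one orientation of an edge; by symmetry of [col] the choice does not affect the
   color. *)
pose ends (e : edge G) :=
  [pick xy : G * G | adj xy.1 xy.2 && (val e == [set xy.1; xy.2])].
pose c := [ffun e : edge G =>
  if ends e is Some xy then inord (col xy.1 xy.2) else ord0 : 'I_k.+1].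
have cE (e : edge G) x y : adj x y -> val e = [set x; y] -> c e = col x y :> nat.
  move=> xy he; rewrite ffunE /ends; case: pickP => [[a b] /= /andP[ab]|/(_ (x, y))].
    rewrite he => /eqP E; rewrite inordK ?bnd //.
    by case: (set2_inj (adj_neq xy) E) => -[-> ->] //; rewrite csym.
  by rewrite /= xy he eqxx.
have bicE x0 x1 x2 x3 x4 : adj x0 x1 -> adj x1 x2 -> adj x2 x3 -> adj x3 x4 ->
    x0 != x2 -> x1 != x3 -> x2 != x4 ->
    ~~ bichromatic c [:: [set x0; x1]; [set x1; x2]; [set x2; x3]; [set x3; x4]].
  move=> a01 a12 a23 a34 n02 n13 n24.
  have [e1 h1] := edge_of a01; have [e2 h2] := edge_of a12.
  have [e3 h3] := edge_of a23; have [e4 h4] := edge_of a34.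
  have [[[C1 C2] C3] C4] := (cE _ _ _ a01 h1, cE _ _ _ a12 h2, cE _ _ _ a23 h3, cE _ _ _ a34 h4).
  rewrite -h1 -h2 -h3 -h4 bichromatic4E -!val_eqE /= ?C1 ?C2 ?C3 ?C4.
  - exact: star.
  - exact: prop.
  - exact: prop.
  - exact: prop.
apply/existsP; exists c; apply/and3P; split.
- apply/forallP => e; apply/forallP => f; apply/implyP => /andP[ef /pred0Pn[z]].
  case/andP=> /= /edge_at[x xz he] /edge_at[y yz hf].
  rewrite -val_eqE /= (cE _ _ _ xz he) (cE _ _ _ yz hf) [col y z]csym //.
  apply: prop => //; first by rewrite adj_sym.
  by apply: contra_neq ef => xy; apply: val_inj; rewrite he hf xy.
- apply/forallP => -[[|x0 [|x1 [|x2 [|x3 [|x4 [|? ?]]]]]] //= ?].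
  apply/implyP; rewrite /= !inE !negb_or -!andbA.
  by do ![case/andP=> ?] => *; apply: bicE.
- apply/forallP => -[[|x0 [|x1 [|x2 [|x3 [|? ?]]]]] //= ?].
  apply/implyP; rewrite /= !inE !negb_or -!andbA.
  (* A 4-cycle is the walk with [x4 = x0], so [x2 != x4] is [x0 != x2] reversed. *)
  by do ![case/andP=> ?] => *; apply: bicE; rewrite // eq_sym.
Qed.

End WalkCharacterization.

(** * A star 6-coloring *)

(* [K_3 x K_3], on pairs of residues. *)
Definition rook3 : rel (nat * nat) :=
  [rel u v | [&& u.1 < 3, u.2 < 3, v.1 < 3, v.2 < 3 &
    (u.1 != v.1) && (u.2 == v.2) || (u.1 == v.1) && (u.2 != v.2)]].

(** Let [w] be the third vertex of the line through [u] and [v]. Modulo 3, the color is [w.2 - w.1]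
    if the first coordinate is constant; otherwise it is 3 plus the residue of [- (w.1 + w.2)]. The
    two directions thus use disjoint palettes. *)
Definition rook3_color (u v : nat * nat) : nat :=
  if u.1 == v.1 then (u.1 + v.1 + 2 * (u.2 + v.2)) %% 3
  else 3 + (u.1 + v.1 + (u.2 + v.2)) %% 3.

Lemma rook3_colorC u v : rook3_color u v = rook3_color v u.
Proof. by rewrite /rook3_color eq_sym (addnC u.1) (addnC u.2). Qed.

Lemma rook3_star_coloring : star_walk_coloring rook3 6 rook3_color.
Proof.
pose vs := [seq (a, b) | a <- iota 0 3, b <- iota 0 3].
have rL u v : rook3 u v -> u \in vs.
  case: u v => [a b] [a' b'] /and5P[/= ha hb _ _ _].
  by apply/allpairsP; exists (a, b); rewrite !mem_iota.
have rR u v : rook3 u v -> v \in vs.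
  case: u v => [a b] [a' b'] /and5P[/= _ _ ha hb _].
  by apply/allpairsP; exists (a', b'); rewrite !mem_iota.
split.
- by move=> x y _; rewrite /rook3_color; case: ifP => _;
    [apply: (@ltn_trans 3)|rewrite -[6]/(3 + 3) ltn_add2l]; rewrite ?ltn_mod.
- by move=> x y _; apply: rook3_colorC.
- have H : all (fun x => all (fun y => rook3 x y ==> all (fun z =>
      rook3 y z && (x != z) ==> (rook3_color x y != rook3_color y z)) vs) vs) vs.
    by vm_compute.
  move=> x y z xy yz xz.
  have /allP/(_ y (rL _ _ yz)) := allP H x (rL _ _ xy).
  by rewrite xy => /allP/(_ z (rR _ _ yz)); rewrite yz xz.
- have H : all (fun x0 => all (fun x1 => rook3 x0 x1 ==> all (fun x2 =>
      rook3 x1 x2 && (x0 != x2) ==> all (fun x3 =>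
      rook3 x2 x3 && (x1 != x3) ==> all (fun x4 =>
      rook3 x3 x4 && (x2 != x4) ==>
        ~~ ((rook3_color x0 x1 == rook3_color x2 x3) &&
            (rook3_color x1 x2 == rook3_color x3 x4))) vs) vs) vs) vs) vs.
    by vm_compute.
  move=> x0 x1 x2 x3 x4 a01 a12 a23 a34 n02 n13 n24.
  have /allP/(_ x1 (rL _ _ a12)) := allP H x0 (rL _ _ a01).
  rewrite a01 => /allP/(_ x2 (rL _ _ a23)); rewrite a12 n02.
  move=> /allP/(_ x3 (rL _ _ a34)); rewrite a23 n13.
  by move=> /allP/(_ x4 (rR _ _ a34)); rewrite a34 n24.
Qed.

(** The wrap-around to 0 respects residues because 3 divides [m]. *)
Lemma ordS_mod3 m (i : 'I_m) : 3 %| m -> ordS i = i.+1 %[mod 3].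
Proof. by move=> d; rewrite /= modn_dvdm. Qed.

Lemma cycle_path_adjE m n
    (x y : cartesian_product (cycle_graph m) (path_graph n)) : adj x y ->
  (x.2 = y.2 /\ (y.1 = ordS x.1 \/ x.1 = ordS y.1)) \/
  (x.1 = y.1 /\ (y.2 = x.2.+1 :> nat \/ x.2 = y.2.+1 :> nat)).
Proof.
case/orP=> [/andP[/andP[_ /orP h] /eqP E]|/andP[/eqP E /orP h]]; [left|right];
  by split=> //; case: h => /eqP; [left|right].
Qed.

Lemma cycle_path_star6 m n : 3 %| m ->
  star_edge_colorable (cartesian_product (cycle_graph m) (path_graph n)) 6.
Proof.
move=> dvd3; set G := cartesian_product _ _.
pose f (x : G) := (x.1 %% 3, x.2 %% 3).
apply: (@star_walk_coloring_edge G 5 (fun x y => rook3_color (f x) (f y))).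
apply: star_walk_coloring_pullback rook3_star_coloring.
- move=> [x1 x2] [y1 y2] /cycle_path_adjE; rewrite /rook3 /f /= !ltn_mod /=.
  have := ordS_mod3 x1 dvd3; have := ordS_mod3 y1 dvd3.
  by move=> hy hx [[-> [E|E]]|[-> [E|E]]]; rewrite -?E in hx hy; lia.
- move=> [x1 x2] [y1 y2] [z1 z2] /cycle_path_adjE/= xy /cycle_path_adjE/= yz [E1 E2].
  have := ordS_mod3 x1 dvd3; have := ordS_mod3 y1 dvd3; have := ordS_mod3 z1 dvd3.
  (* Two steps in the same sense shift one residue by 2 or -2, and a mixed pair shifts each residue
     by 1 or -1. Only a step and its reverse preserve both residues. *)
  move=> hz hy hx; case: xy yz => [[? [e|e]]|[? e]] [[? [e'|e']]|[? e']]; subst.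
  + by exfalso; lia.
  + by congr pair; apply: ordS_inj.
  + by exfalso; lia.
  + by [].
  + by exfalso; lia.
  + by exfalso; lia.
  + by exfalso; lia.
  + by exfalso; lia.
  + by congr pair; apply: val_inj => /=; lia.
Qed.

(** * No star 5-coloring *)

(* The quadruple [(i, j, k, l)] forbids a coloring [c] with [c i = c k] and
   [c j = c l]; the quadruple [(i, i, j, j)] thus forbids [c i = c j]. *)
Definition constraint_ok (c : nat -> nat) (q : nat * nat * nat * nat) : bool :=
  let: (i, j, k, l) := q in ~~ ((c i == c k) && (c j == c l)).

Definition constraint_max (q : nat * nat * nat * nat) : nat :=
  let: (i, j, k, l) := q in maxn (maxn i j) (maxn k l).

(* [m] is the number of colors used so far; only restricted growth strings are
   enumerated, i.e. colorings up to a permutation of the colors. *)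
Fixpoint search (k : nat) (cs : seq (seq (nat * nat * nat * nat))) (s : seq nat)
    (m : nat) : bool :=
  if cs is c :: cs' then
    has (fun a => let s' := rcons s a in
      if all (constraint_ok (nth 0 s')) c then search k cs' s' (maxn m a.+1)
      else false) (iota 0 (minn k m.+1))
  else true.

(* [d] lists the colors of [f] met so far in order of first occurrence, so that
   [index (f j) d] is the canonical renaming of the color [f j]. *)
Lemma search_sound_at k cs f i d :
  (forall j, j < size cs -> f (i + j) < k) ->
  (forall j q, j < size cs -> q \in nth [::] cs j ->
     constraint_max q <= i + j /\ constraint_ok f q) ->
  uniq d -> (forall j, j < i -> f j \in d) -> (forall a, a \in d -> a < k) ->
  search k cs (mkseq (fun j => index (f j) d) i) (size d).
Proof.
elim: cs i d => [//|c cs IH] i d fk ok uniq_d fd dk.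
pose d' := if f i \in d then d else rcons d (f i).
have fi_k : f i < k by have := fk 0 isT; rewrite addn0.
have uniq_d' : uniq d' by rewrite /d'; case: ifP => // h; rewrite rcons_uniq h.
have fd' j : j < i.+1 -> f j \in d'.
  rewrite ltnS leq_eqVlt /d' => /predU1P[->|/fd h]; case: ifP => //.
    by rewrite mem_rcons mem_head.
  by rewrite mem_rcons in_cons h orbT.
have d'k a : a \in d' -> a < k.
  rewrite /d'; case: ifP => _; first exact: dk.
  by rewrite mem_rcons in_cons => /predU1P[->|/dk].
have size_d' : size d' <= k.
  rewrite -(size_iota 0 k) uniq_leq_size // => a /d'k.
  by rewrite mem_iota.
have idx j : j < i -> index (f j) d' = index (f j) d.
  by move=> /fd h; rewrite /d'; case: ifP => // _; rewrite -cats1 index_cat h.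
have size_d'E : maxn (size d) (index (f i) d').+1 = size d'.
  rewrite /d'; case: ifP => h; first by apply/maxn_idPl; rewrite index_mem.
  by rewrite -cats1 index_cat h /= eqxx addn0 size_cat addn1; apply/maxn_idPr.
have s'E : rcons (mkseq (fun j => index (f j) d) i) (index (f i) d') =
           mkseq (fun j => index (f j) d') i.+1.
  rewrite mkseqS; congr rcons; apply/eq_in_map => j.
  by rewrite mem_iota => /idx ->.
have idx_eq j l : j <= i -> l <= i ->
    (index (f j) d' == index (f l) d') = (f j == f l).
  by move=> hj hl; apply: (inj_in_eq (@index_inj _ 0 d')); apply: fd'.
have idx_lt : index (f i) d' < size d' by rewrite index_mem fd'.
rewrite /=; apply/hasP; exists (index (f i) d').
  rewrite mem_iota /= add0n leq_min (leq_trans idx_lt) //=.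
  by rewrite (leq_trans idx_lt) // /d'; case: ifP; rewrite ?size_rcons.
(* The constraints of this level involve only edges up to [i], where renaming is injective, so they
   transfer from [f]. *)
rewrite s'E ifT; last first.
  apply/allP => q qc; have [] := ok 0 q isT qc; rewrite addn0.
  case: q {qc} => [[[a b] e] g] /=; rewrite !geq_max -!andbA => /and4P[ha hb he hg].
  by rewrite !nth_mkseq // !idx_eq.
rewrite size_d'E; apply: IH => // [j hj|j q hj hq].
  by rewrite addSnnS; apply: fk.
by rewrite addSnnS; apply: ok.
Qed.

(** * The strip of width 3 and its constraints *)

Definition strip : rel (nat * nat) :=
  [rel u v | [&& u.2 < 3, v.2 < 3 &
    ((v.1 == u.1.+1) || (u.1 == v.1.+1)) && (u.2 == v.2) ||
    (u.1 == v.1) && ((v.2 == u.2.+1) || (u.2 == v.2.+1))]].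

Arguments strip : simpl never.

Definition strip_vertices : seq (nat * nat) :=
  [seq (a, b) | a <- iota 0 5, b <- iota 0 3].

(** Coordinate sums of neighbors differ by 1, so the inequality lists each edge once. Every edge
    appears with its later endpoint, column by column, which keeps the colored part connected and
    lets the search prune early. *)
Definition strip_edges : seq ((nat * nat) * (nat * nat)) :=
  [seq (u, v) | u <- strip_vertices,
                v <- [seq v <- strip_vertices | strip u v && (v.1 + v.2 < u.1 + u.2)]].

(* The default vertex [(0, 7)] lies outside the strip, so it excludes no first step. *)
Fixpoint strip_walks (l : nat) : seq (seq (nat * nat)) :=
  if l is l'.+1 then
    [seq u :: w | w <- strip_walks l',
       u <- [seq u <- strip_vertices | strip u (head u w) && (u != nth (0, 7) w 1)]]
  else [seq [:: u] | u <- strip_vertices].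

Definition joins (u v : nat * nat) : pred ((nat * nat) * (nat * nat)) :=
  fun e => (e == (u, v)) || (e == (v, u)).

Definition edge_index (u v : nat * nat) : nat := find (joins u v) strip_edges.

Definition indexed (u v : nat * nat) : bool := has (joins u v) strip_edges.

Arguments edge_index : simpl never.
Arguments indexed : simpl never.

(** The default quadruple is unsatisfiable; [valid_walk] rules out the lengths that would produce
    it. *)
Definition walk_constraint (w : seq (nat * nat)) : nat * nat * nat * nat :=
  match w with
  | [:: x; y; z] =>
      (edge_index x y, edge_index x y, edge_index y z, edge_index y z)
  | [:: x0; x1; x2; x3; x4] =>
      (edge_index x0 x1, edge_index x1 x2, edge_index x2 x3, edge_index x3 x4)
  | _ => (0, 0, 0, 0)
  end.

Definition constraints : seq (nat * nat * nat * nat) :=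
  map walk_constraint (strip_walks 2 ++ strip_walks 4).

(** Each constraint is tested as soon as its last edge receives a color. *)
Definition leveled_constraints : seq (seq (nat * nat * nat * nat)) :=
  [seq [seq q <- constraints | constraint_max q == i] | i <- iota 0 (size strip_edges)].

Definition valid_walk (w : seq (nat * nat)) : bool :=
  all (fun e => strip e.1 e.2 && indexed e.1 e.2)
      (zip w (behead w)) &&
  match w with
  | [:: x; y; z] => x != z
  | [:: x0; x1; x2; x3; x4] => [&& x0 != x2, x1 != x3 & x2 != x4]
  | _ => false
  end.

(** Soundness of the generator: every constraint handed to the search comes from a genuine
    non-backtracking walk, so any star coloring satisfies it. *)
Lemma strip_walks_valid : all valid_walk (strip_walks 2 ++ strip_walks 4).
Proof. by vm_compute. Qed.

Lemma strip_edges_adj : all (fun e => strip e.1 e.2) strip_edges.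
Proof. by vm_compute. Qed.

Lemma strip_search : search 5 leveled_constraints [::] 0 = false.
Proof. by vm_compute. Qed.

Lemma strip_not_star5 col : ~ star_walk_coloring strip 5 col.
Proof.
case=> bnd csym prop star.
pose f i := let e := nth ((0, 0), (0, 0)) strip_edges i in col e.1 e.2.
have fE u v : strip u v -> indexed u v ->
    f (edge_index u v) = col u v.
  rewrite /f /edge_index => uv /(nth_find ((0, 0), (0, 0))).
  by case/orP=> /eqP->; rewrite //= (csym u v).
have fok w : valid_walk w -> constraint_ok f (walk_constraint w).
  case: w => [|x0 [|x1 [|x2 [|x3 [|x4 [|? ?]]]]]]; rewrite /valid_walk /= ?andbF //.
  - case/andP=> /and3P[/andP[a01 i01] /andP[a12 i12] _] n02.
    by rewrite !fE // andbb; apply: prop.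
  - case/andP=> /and5P[/andP[a01 i01] /andP[a12 i12] /andP[a23 i23] /andP[a34 i34] _].
    by case/and3P=> n02 n13 n24; rewrite !fE //; apply: star.
have szL : size leveled_constraints = size strip_edges.
  by rewrite size_map size_iota.
suff : search 5 leveled_constraints [::] 0 by rewrite strip_search.
(* At the start no edge is colored and no color has been met. *)
apply: (@search_sound_at 5 leveled_constraints f 0 [::]) => // [j|j q];
  rewrite szL => hj.
  exact/bnd/(allP strip_edges_adj)/mem_nth.
rewrite (nth_map 0) ?size_iota // nth_iota // mem_filter => /andP[/eqP-> /mapP[w]].
by move=> /(allP strip_walks_valid) hw ->; rewrite fok.
Qed.

(** * Wrapping the strip around the cycle *)

(** A multiple of [m] that is at most 2 vanishes. Since two neighbors of a strip vertex are at most
    2 columns apart, this makes the wrapping map injective on neighborhoods. *)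
Lemma eqn_mod_close m a b : 3 <= m -> a <= b + 2 -> b <= a + 2 ->
  a = b %[mod m] -> a = b.
Proof.
move=> m3; wlog le_ab : a b / a <= b => [W|_ ba E].
  have [/W//|/ltnW/W h] := leqP a b; move=> *; symmetry; exact: h.
have : m %| b - a by rewrite -eqn_mod_dvd // E.
have [|lt0] := posnP (b - a); first by lia.
by move/(dvdn_leq lt0); lia.
Qed.

Lemma cycle_path_not_star5 m n j : 3 <= m -> 3 <= n -> j <= 5 ->
  ~~ star_edge_colorable (cartesian_product (cycle_graph m) (path_graph n)) j.
Proof.
case: m n => // m [//|n] m3 n3 j5; set G := cartesian_product _ _.
apply/negP => /existsP[c /star_edge_coloring_walk cW].
have {}cW : star_walk_coloring (@adj G) 5 (walk_color c).
  by case: cW => bnd *; split=> // x y /bnd/leq_trans->.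
(* Columns wind around the cycle, and the three rows go to the first three vertices of the path. *)
pose f (u : nat * nat) : G := (inord (u.1 %% m.+1), inord u.2).
apply: (@strip_not_star5 (fun u v => walk_color c (f u) (f v))).
have fS i : inord (i.+1 %% m.+1) = ordS (inord (i %% m.+1)) :> 'I_m.+1.
  apply: val_inj; rewrite /= !inordK ?ltn_mod // -[in RHS]addn1 modnDml addn1 //.
have nS (i : 'I_m.+1) : i != ordS i.
  apply/eqP => /(congr1 val) /= E; have := @eqn_mod_close m.+1 i i.+1 m3.
  by rewrite -E modn_small ?ltn_ord //; lia.
apply: star_walk_coloring_pullback cW.
- move=> [a b] [a' b']; rewrite /strip /= => /and3P[hb hb'].
  case/orP=> /andP[] => [/orP[]/eqP-> /eqP->|/eqP-> h]; apply/orP; [left|left|right].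
  + by rewrite /= eqxx andbT fS /cycle_adj /= nS eqxx.
  + by rewrite /= eqxx andbT fS /cycle_adj /= eq_sym nS eqxx orbT.
  + by rewrite /= eqxx /= /path_adj /= !inordK ?(leq_trans _ n3).
- move=> [x1 x2] [y1 y2] [z1 z2]; rewrite /strip /= => xy yz [/(congr1 val)/=].
  rewrite !inordK ?ltn_mod // => E1 /(congr1 val)/=.
  have [hx hz] : x2 < 3 /\ z2 < 3 by lia.
  rewrite !inordK ?(leq_trans hx n3) ?(leq_trans hz n3) //.
  by move=> E2; congr pair => //; apply: eqn_mod_close E1 => //; lia.
Qed.

Theorem theorem22 (k n : nat) (k_gt0 : 0 < k) (n_ge3 : 3 <= n) :
  star_chromatic_index
    (cartesian_product (cycle_graph (3 * k)) (path_graph n)) = 6.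
Proof.
rewrite /star_chromatic_index; case: ex_minnP => j colj jmin.
apply/eqP; rewrite eqn_leq jmin ?cycle_path_star6 ?dvdn_mulr //= ltnNge.
by apply: contraL colj => /(cycle_path_not_star5 _ n_ge3) ->; rewrite // leq_pmulr.
Qed.
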